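(* Let $F: \mathcal{C} \to \mathcal{D}$ be a tensor functor between tensor categories over a field $k$ that has a left adjoint $L$ and a right adjoint $R$ and satisfies the following equivalent conditions: (a) $L$ has a left adjoint; (b) $R$ has a right adjoint; (c) there is an object $\chi_F \in \mathcal{D}$ such that $R \cong L(- \otimes \chi_F)$. The relative modular object $\chi_F$ of $F$ has the following properties: (1) $\chi_F \cong \mathbf{1}$ if and only if $F$ is Frobenius. (2) $\chi_F$ is an invertible object. (3) $\chi_F$ belongs to the centralizer of $F$, i.e. there is a natural isomorphism $\sigma$ such that $(\chi_F, \sigma)$ is an object of $\mathcal{Z}(F)$.
   Context: $k$ is an arbitrary field. A tensor category is a $k$-linear abelian category endowed with a rigid monoidal structure whose tensor product is $k$-bilinear (the unit object $\mathbf{1}$ is not assumed simple). A tensor functor is a $k$-linear strong monoidal functor between tensor categories. For $F$ as in the claim, the object $\chi_F$ in condition (c) is unique up to isomorphism and is called the relative modular object of $F$. A functor is Frobenius if it has a left adjoint and a right adjoint that are isomorphic. Centralizer: let $F: \mathcal{C} \to \mathcal{D}$ be a monoidal functor with structure morphisms $F_0: \mathbf{1} \to F(\mathbf{1})$ and $F_2(X,Y): F(X) \otimes F(Y) \to F(X \otimes Y)$. An object of the centralizer $\mathcal{Z}(F)$ is a pair $(V, \sigma)$ of an object $V \in \mathcal{D}$ and a natural isomorphism $\sigma(X): V \otimes F(X) \to F(X) \otimes V$ ($X \in \mathcal{C}$) such that $\sigma(\mathbf{1}) \circ (\mathrm{id}_V \otimes F_0) = F_0 \otimes \mathrm{id}_V$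 and $\sigma(X \otimes Y) \circ (\mathrm{id}_V \otimes F_2(X,Y)) = (F_2(X,Y) \otimes \mathrm{id}_V) \circ (\mathrm{id}_{F(X)} \otimes \sigma(Y)) \circ (\sigma(X) \otimes \mathrm{id}_{F(Y)})$ for all $X, Y \in \mathcal{C}$. *)

(* Defs.v *)
From mathcomp Require Import all_boot all_algebra.

Set Implicit Arguments.
Unset Strict Implicit.
Unset Printing Implicit Defensive.

Import GRing.Theory.
Local Open Scope ring_scope.

Declare Scope cat_scope.
Delimit Scope cat_scope with cat.
Local Open Scope cat_scope.

(* [comp g f] is "g after f". *)
Record lincat (k : fieldType) := LinCat {
  ob :> Type;
  hom : ob -> ob -> lmodType k;
  idm : forall X : ob, hom X X;
  comp : forall X Y Z : ob, hom Y Z -> hom X Y -> hom X Z;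
  comp1m : forall (X Y : ob) (f : hom X Y), comp (idm Y) f = f;
  compm1 : forall (X Y : ob) (f : hom X Y), comp f (idm X) = f;
  compA : forall (W X Y Z : ob) (h : hom Y Z) (g : hom X Y) (f : hom W X),
    comp h (comp g f) = comp (comp h g) f;
  comp_linearl : forall (X Y Z : ob) (f : hom X Y),
    linear (fun g : hom Y Z => comp g f);
  comp_linearr : forall (X Y Z : ob) (g : hom Y Z),
    linear (fun f : hom X Y => comp g f)
}.

Arguments hom {k C} X Y : rename.
Arguments idm {k C} X : rename.
Arguments comp {k C X Y Z} g f : rename.

Notation "g '\oc' f" := (comp g f)
  (at level 45, left associativity) : cat_scope.

Section Category.
Context {k : fieldType} {C : lincat k}.
Implicit Types X Y Z : C.

Record iso X Y := Iso {
  isoh : hom X Y;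
  isoi : hom Y X;
  isohK : isoi \oc isoh = idm X;
  isoiK : isoh \oc isoi = idm Y
}.

Definition isomorphic X Y : Prop := inhabited (iso X Y).

Definition mono X Y (f : hom X Y) : Prop :=
  forall Z (g h : hom Z X), f \oc g = f \oc h -> g = h.

Definition epi X Y (f : hom X Y) : Prop :=
  forall Z (g h : hom Y Z), g \oc f = h \oc f -> g = h.

Definition is_kernel X Y K (f : hom X Y) (i : hom K X) : Prop :=
  f \oc i = 0 /\
  forall Z (g : hom Z X), f \oc g = 0 -> exists! h : hom Z K, i \oc h = g.

Definition is_cokernel X Y Q (f : hom X Y) (p : hom Y Q) : Prop :=
  p \oc f = 0 /\
  forall Z (g : hom Y Z), g \oc f = 0 -> exists! h : hom Q Z, h \oc p = g.

Definition is_zero X : Prop :=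
  forall Y, (forall f : hom X Y, f = 0) /\ (forall f : hom Y X, f = 0).

Definition is_biproduct X Y S : Prop :=
  exists (iX : hom X S) (iY : hom Y S) (pX : hom S X) (pY : hom S Y),
    [/\ pX \oc iX = idm X, pY \oc iY = idm Y, pX \oc iY = 0, pY \oc iX = 0
      & iX \oc pX + iY \oc pY = idm S].

End Category.

Record abelian (k : fieldType) (C : lincat k) : Prop := Abelian {
  abelian_zero : exists X : C, is_zero X;
  abelian_biproduct : forall X Y : C, exists S : C, is_biproduct X Y S;
  abelian_kernel : forall (X Y : C) (f : hom X Y),
    exists (K : C) (i : hom K X), is_kernel f i;
  abelian_cokernel : forall (X Y : C) (f : hom X Y),
    exists (Q : C) (p : hom Y Q), is_cokernel f p;
  abelian_mono : forall (X Y : C) (f : hom X Y), mono f ->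
    exists (Z : C) (g : hom Y Z), is_kernel g f;
  abelian_epi : forall (X Y : C) (f : hom X Y), epi f ->
    exists (Z : C) (g : hom Z X), is_cokernel g f
}.

(* Functors are not required to be k-linear; see [tensorFunctor]. *)
Record functor (k : fieldType) (C D : lincat k) := Functor {
  fob :> C -> D;
  fmap : forall X Y : C, hom X Y -> hom (fob X) (fob Y);
  fmap1 : forall X : C, fmap (idm X) = idm (fob X);
  fmapM : forall (X Y Z : C) (g : hom Y Z) (f : hom X Y),
    fmap (g \oc f) = fmap g \oc fmap f
}.

Arguments fmap {k C D} F {X Y} f : rename.

Record natiso (k : fieldType) (C D : lincat k) (F G : functor C D) := NatIso {
  natiso_comp :> forall X : C, iso (F X) (G X);
  natiso_nat : forall (X Y : C) (f : hom X Y),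
    isoh (natiso_comp Y) \oc fmap F f = fmap G f \oc isoh (natiso_comp X)
}.

Definition functor_isomorphic (k : fieldType) (C D : lincat k)
  (F G : functor C D) : Prop := inhabited (natiso F G).

(* [adjunction L R] : L is left adjoint to R. *)
Record adjunction (k : fieldType) (C D : lincat k)
    (L : functor D C) (R : functor C D) := Adjunction {
  adj_unit : forall V : D, hom V (R (L V));
  adj_counit : forall X : C, hom (L (R X)) X;
  adj_unit_nat : forall (V W : D) (f : hom V W),
    adj_unit W \oc f = fmap R (fmap L f) \oc adj_unit V;
  adj_counit_nat : forall (X Y : C) (f : hom X Y),
    adj_counit Y \oc fmap L (fmap R f) = f \oc adj_counit X;
  adj_triangleL : forall V : D,
    adj_counit (L V) \oc fmap L (adj_unit V) = idm (L V);
  adj_triangleR : forall X : C,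
    fmap R (adj_counit X) \oc adj_unit (R X) = idm (R X)
}.

Definition has_left_adjoint (k : fieldType) (C D : lincat k)
  (F : functor C D) : Prop := exists L : functor D C, inhabited (adjunction L F).

Definition has_right_adjoint (k : fieldType) (C D : lincat k)
  (F : functor C D) : Prop := exists R : functor D C, inhabited (adjunction F R).

Definition frobenius (k : fieldType) (C D : lincat k) (F : functor C D) : Prop :=
  exists L R : functor D C,
    [/\ inhabited (adjunction L F), inhabited (adjunction F R)
      & functor_isomorphic L R].

Section CompFunctor.
Context {k : fieldType} {C D E : lincat k}.
Variables (G : functor D E) (F : functor C D).

Fact comp_functor_id (X : C) : fmap G (fmap F (idm X)) = idm (G (F X)).
Proof. by rewrite !fmap1. Qed.

Fact comp_functor_comp (X Y Z : C) (g : hom Y Z) (f : hom X Y) :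
  fmap G (fmap F (g \oc f)) = fmap G (fmap F g) \oc fmap G (fmap F f).
Proof. by rewrite !fmapM. Qed.

Definition comp_functor : functor C E :=
  @Functor k C E (fun X => G (F X)) (fun X Y f => fmap G (fmap F f))
    comp_functor_id comp_functor_comp.

End CompFunctor.

Record monoidalCategory (k : fieldType) := MonoidalCategory {
  mcat :> lincat k;
  tens : mcat -> mcat -> mcat;
  tensm : forall X X' Y Y' : mcat,
    hom X X' -> hom Y Y' -> hom (tens X Y) (tens X' Y');
  munit : mcat;
  massoc : forall X Y Z : mcat, iso (tens (tens X Y) Z) (tens X (tens Y Z));
  lunit : forall X : mcat, iso (tens munit X) X;
  runit : forall X : mcat, iso (tens X munit) X;
  tensm1 : forall X Y : mcat, tensm (idm X) (idm Y) = idm (tens X Y);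
  tensmM : forall (X X' X'' Y Y' Y'' : mcat) (f' : hom X' X'') (f : hom X X')
      (g' : hom Y' Y'') (g : hom Y Y'),
    tensm (f' \oc f) (g' \oc g) = tensm f' g' \oc tensm f g;
  massoc_nat : forall (X X' Y Y' Z Z' : mcat)
      (f : hom X X') (g : hom Y Y') (h : hom Z Z'),
    isoh (massoc X' Y' Z') \oc tensm (tensm f g) h
      = tensm f (tensm g h) \oc isoh (massoc X Y Z);
  lunit_nat : forall (X X' : mcat) (f : hom X X'),
    isoh (lunit X') \oc tensm (idm munit) f = f \oc isoh (lunit X);
  runit_nat : forall (X X' : mcat) (f : hom X X'),
    isoh (runit X') \oc tensm f (idm munit) = f \oc isoh (runit X);
  pentagon : forall W X Y Z : mcat,
    isoh (massoc W X (tens Y Z)) \oc isoh (massoc (tens W X) Y Z)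
      = tensm (idm W) (isoh (massoc X Y Z))
        \oc isoh (massoc W (tens X Y) Z)
        \oc tensm (isoh (massoc W X Y)) (idm Z);
  triangle : forall X Y : mcat,
    tensm (idm X) (isoh (lunit Y)) \oc isoh (massoc X munit Y)
      = tensm (isoh (runit X)) (idm Y)
}.

Arguments tens {k m} X Y.
Arguments tensm {k m X X' Y Y'} f g.
Arguments munit {k} m.
Arguments massoc {k m} X Y Z.
Arguments lunit {k m} X.
Arguments runit {k m} X.

Notation "X ⊗ Y" := (tens X Y)
  (at level 40, left associativity) : cat_scope.
Notation "f ⊗m g" := (tensm f g)
  (at level 40, left associativity) : cat_scope.

Definition tensor_bilinear (k : fieldType) (M : monoidalCategory k) : Prop :=
  (forall (X X' Y Y' : M) (g : hom Y Y'),
     linear (fun f : hom X X' => f ⊗m g)) /\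
  (forall (X X' Y Y' : M) (f : hom X X'),
     linear (fun g : hom Y Y' => f ⊗m g)).

(* Y is a left dual of X (evaluation Y ⊗ X -> 1, coevaluation 1 -> X ⊗ Y);
   equivalently, X is a right dual of Y. *)
Definition left_dual (k : fieldType) (M : monoidalCategory k) (Y X : M) : Prop :=
  exists (ev : hom (Y ⊗ X) (munit M)) (coev : hom (munit M) (X ⊗ Y)),
    isoh (runit X) \oc (idm X ⊗m ev) \oc isoh (massoc X Y X) \oc (coev ⊗m idm X)
      = isoh (lunit X) /\
    isoh (lunit Y) \oc (ev ⊗m idm Y) \oc isoi (massoc Y X Y) \oc (idm Y ⊗m coev)
      = isoh (runit Y).

Definition rigid (k : fieldType) (M : monoidalCategory k) : Prop :=
  forall X : M, (exists Y : M, left_dual Y X) /\ (exists Y : M, left_dual X Y).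

Record tensorCategory (k : fieldType) := TensorCategory {
  tcat :> monoidalCategory k;
  tcat_abelian : abelian tcat;
  tcat_bilinear : tensor_bilinear tcat;
  tcat_rigid : rigid tcat
}.

Definition invertible (k : fieldType) (M : monoidalCategory k) (X : M) : Prop :=
  exists Y : M, isomorphic (X ⊗ Y) (munit M) /\ isomorphic (Y ⊗ X) (munit M).

Section TensorRight.
Context {k : fieldType} {M : monoidalCategory k}.
Variable V : M.

Fact tens_right_id (X : M) : idm X ⊗m idm V = idm (X ⊗ V).
Proof. exact: tensm1. Qed.

Fact tens_right_comp (X Y Z : M) (g : hom Y Z) (f : hom X Y) :
  (g \oc f) ⊗m idm V = (g ⊗m idm V) \oc (f ⊗m idm V).
Proof. by rewrite -tensmM comp1m. Qed.

Definition tens_right : functor M M :=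
  @Functor k M M (fun X => X ⊗ V) (fun X Y f => f ⊗m idm V)
    tens_right_id tens_right_comp.

End TensorRight.

Record tensorFunctor (k : fieldType) (C D : tensorCategory k) := TensorFunctor {
  tfun :> functor C D;
  tfun_linear : forall X Y : C, linear (fun f : hom X Y => fmap tfun f);
  tfun0 : iso (munit D) (tfun (munit C));
  tfun2 : forall X Y : C, iso (tfun X ⊗ tfun Y) (tfun (X ⊗ Y));
  tfun2_nat : forall (X X' Y Y' : C) (f : hom X X') (g : hom Y Y'),
    isoh (tfun2 X' Y') \oc (fmap tfun f ⊗m fmap tfun g)
      = fmap tfun (f ⊗m g) \oc isoh (tfun2 X Y);
  tfun2_assoc : forall X Y Z : C,
    fmap tfun (isoh (massoc X Y Z)) \oc isoh (tfun2 (X ⊗ Y) Z)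
        \oc (isoh (tfun2 X Y) ⊗m idm (tfun Z))
      = isoh (tfun2 X (Y ⊗ Z)) \oc (idm (tfun X) ⊗m isoh (tfun2 Y Z))
        \oc isoh (massoc (tfun X) (tfun Y) (tfun Z));
  tfun_lunit : forall X : C,
    fmap tfun (isoh (lunit X)) \oc isoh (tfun2 (munit C) X)
        \oc (isoh tfun0 ⊗m idm (tfun X))
      = isoh (lunit (tfun X));
  tfun_runit : forall X : C,
    fmap tfun (isoh (runit X)) \oc isoh (tfun2 X (munit C))
        \oc (idm (tfun X) ⊗m isoh tfun0)
      = isoh (runit (tfun X))
}.

Arguments tfun0 {k C D} F : rename.
Arguments tfun2 {k C D} F X Y : rename.

(* (V, sigma) is an object of the centralizer Z(F); the associators and
   unitors that are invisible in a strict D are inserted. *)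
Record centralizer_object (k : fieldType) (C D : tensorCategory k)
    (F : tensorFunctor C D) (V : D)
    (sigma : forall X : C, iso (V ⊗ F X) (F X ⊗ V)) : Prop := CentralizerObject {
  centralizer_nat : forall (X Y : C) (f : hom X Y),
    isoh (sigma Y) \oc (idm V ⊗m fmap F f)
      = (fmap F f ⊗m idm V) \oc isoh (sigma X);
  centralizer_unit :
    isoh (sigma (munit C)) \oc (idm V ⊗m isoh (tfun0 F))
      = (isoh (tfun0 F) ⊗m idm V) \oc isoi (lunit V) \oc isoh (runit V);
  centralizer_tens : forall X Y : C,
    isoh (sigma (X ⊗ Y)) \oc (idm V ⊗m isoh (tfun2 F X Y))
      = (isoh (tfun2 F X Y) ⊗m idm V)
        \oc isoi (massoc (F X) (F Y) V)
        \oc (idm (F X) ⊗m isoh (sigma Y))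
        \oc isoh (massoc (F X) V (F Y))
        \oc (isoh (sigma X) ⊗m idm (F Y))
        \oc isoi (massoc V (F X) (F Y))
}.

(* [relative_modular_object L R chi] : R ≅ L(- ⊗ chi), for L and R the left and
   right adjoints of a tensor functor C -> D. *)
Definition relative_modular_object (k : fieldType) (C D : tensorCategory k)
  (L R : functor D C) (chi : D) : Prop :=
  functor_isomorphic R (comp_functor L (tens_right chi)).

(* Main.v *)
From mathcomp Require Import all_boot all_algebra.
From Stdlib Require Import IndefiniteDescription.
Require Import Defs.

(** Write [L] and [R] for the left and right adjoints of [F].  The proof replaces
the condition [R ≅ L(- ⊗ chi)] by one that does not mention tensor products:
[chi] carries a universal arrow [u : 1 -> L chi], that is, [chi] represents the
functor [W |-> Hom(1, L W)].  This condition depends on [L] alone, it determines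
[chi] up to isomorphism, and it is unchanged when the tensor products of both
categories are reversed.  So every statement derived from it has a mirror image
for free, by applying it to [rev_functor F].

Two facts about duality carry everything.  First, [F] preserves duals, hence the
projection formula [L(V ⊗ F X) ≅ L V ⊗ X] ([proj_iso]); with it the universal
arrow at [1] spreads to universal arrows [X -> L(chi ⊗ F X)] and
[X -> L(F X ⊗ chi)] ([universal_at], [universal_atl]).  Second, [R V] is a dual
of [L W] whenever [V] is a dual of [W] ([pairing_form_bij]), which turns
statements about [R] into statements about [L].

Existence of the universal arrow.  A left adjoint [E] of [L] gives it at once,
with [chi = E 1].  In the other two cases [W' |-> Hom(R W', 1)] is represented by
a dual [chi'] of [chi]: by the right adjoint of [R] evaluated at [1], or because
[Hom(L(W' ⊗ chi), 1) ≅ Hom(W' ⊗ chi, 1) ≅ Hom(W', chi')].  For [W'] dual to [W],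
the pairing of [R W'] with [L W] gives
[Hom(1, L W) ≅ Hom(R W', 1) ≅ Hom(W', chi') ≅ Hom(chi, W)]
([universal_of_form]).  The passage from [R] to [chi'] may use any left
adjoint of [F], and the conclusion concerns [L] alone; this is why [F] Frobenius
forces [chi ≅ 1] without comparing different adjoints of [F].

Invertibility.  For [W'] dual to [W], the universal property of [u] makes
[L(W ⊗ chi)] a dual of [L W'] ([copair_universal]), whence
[Hom(1, L(W ⊗ chi)) ≅ Hom(L W', 1) ≅ Hom(W', 1) ≅ Hom(1, W)].  On the other hand
[Hom(1, L(W ⊗ chi)) ≅ Hom(chi, W ⊗ chi) ≅ Hom(chi ⊗ chi', W)], and the composite
is precomposition with the evaluation [chi ⊗ chi' -> 1], which is therefore an
isomorphism ([ev_iso]).  The unit object may be decomposable, so a one-sided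
inverse need not be enough; the mirror image supplies the other side.

Relative modularity.  Since [- ⊗ chi] is now fully faithful, the universal arrows
[X -> L(F X ⊗ chi)] are the unit of an adjunction between [F] and [L(- ⊗ chi)], so
[R ≅ L(- ⊗ chi)] by uniqueness of right adjoints.

Centralizer.  The isomorphism [sigma X] is the one that compares the two universal
arrows at [X].  Along the projection formulas it corresponds to a map
[L chi ⊗ X -> X ⊗ L chi] that moves [u] across [X]; maps of this kind are
determined by what they do to [u] ([mates_uniq]), and this proves naturality, the
unit axiom and the hexagon. *)

Set Implicit Arguments.
Unset Strict Implicit.
Unset Printing Implicit Defensive.

Local Open Scope cat_scope.

(** * Isomorphisms and bijections between Hom spaces *)

Section Composition.
Context {k : fieldType} {C : lincat k}.
Implicit Types V W X Y Z : C.

(** Composition associates to the left; this rewrites a composable pair in the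
middle of a chain, and the next lemma a triple. *)
Lemma comp_rw2 X Y Z (g : hom Y Z) (f : hom X Y) h : g \oc f = h ->
  forall W (x : hom Z W), x \oc g \oc f = x \oc h.
Proof. by move=> <- W x; rewrite compA. Qed.

Lemma comp_rw3 V X Y Z (h : hom Y Z) (g : hom X Y) (f : hom V X) r :
  h \oc g \oc f = r -> forall W (x : hom Z W), x \oc h \oc g \oc f = x \oc r.
Proof. by move=> <- W x; rewrite !compA. Qed.

Lemma isohKc X Y Z (i : iso X Y) (f : hom X Z) : f \oc isoi i \oc isoh i = f.
Proof. by rewrite -compA isohK compm1. Qed.

Lemma isoiKc X Y Z (i : iso X Y) (f : hom Y Z) : f \oc isoh i \oc isoi i = f.
Proof. by rewrite -compA isoiK compm1. Qed.

Lemma isoh_inj X Y Z (i : iso X Y) (f g : hom Z X) :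
  isoh i \oc f = isoh i \oc g -> f = g.
Proof.
by move=> e; rewrite -[f]comp1m -[g]comp1m -(isohK i) -!compA e.
Qed.

Lemma isoh_injr X Y Z (i : iso X Y) (f g : hom Y Z) :
  f \oc isoh i = g \oc isoh i -> f = g.
Proof. by move=> e; rewrite -[f](isoiKc i) e isoiKc. Qed.

Lemma iso_inv_eq X Y (i j : iso X Y) : isoh i = isoh j -> isoi i = isoi j.
Proof.
by move=> e; apply: (isoh_injr (i := i)); rewrite isohK e isohK.
Qed.

Definition iso_id X : iso X X := Iso (comp1m (idm X)) (comp1m (idm X)).

Definition iso_sym X Y (i : iso X Y) : iso Y X := Iso (isoiK i) (isohK i).

Fact iso_trans_subproof X Y Z (i : iso X Y) (j : iso Y Z) :
  (isoi i \oc isoi j) \oc (isoh j \oc isoh i) = idm X /\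
  (isoh j \oc isoh i) \oc (isoi i \oc isoi j) = idm Z.
Proof. by rewrite !compA isohKc isohK isoiKc isoiK. Qed.

Definition iso_trans X Y Z (i : iso X Y) (j : iso Y Z) : iso X Z :=
  Iso (iso_trans_subproof i j).1 (iso_trans_subproof i j).2.

Definition is_iso X Y (f : hom X Y) : Prop := exists i : iso X Y, isoh i = f.

Lemma bij_precomp X Y Z (i : iso X Y) :
  bijective (fun h : hom Y Z => h \oc isoh i).
Proof.
by exists (fun h => h \oc isoi i) => h; rewrite ?isoiKc ?isohKc.
Qed.

Lemma bij_postcomp X Y Z (i : iso X Y) :
  bijective (fun h : hom Z X => isoh i \oc h).
Proof.
by exists (fun h => isoi i \oc h) => h; rewrite compA ?isohK ?isoiK comp1m.
Qed.

Lemma yoneda_pre X Y (f : hom X Y) :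
  (forall Z, bijective (fun h : hom Y Z => h \oc f)) -> is_iso f.
Proof.
move=> bf; have [g gK fK] := bf X.
have e1 : g (idm X) \oc f = idm X by exact: fK.
suff e2 : f \oc g (idm X) = idm Y by exists (Iso e1 e2).
by apply: (bij_inj (bf Y)); rewrite /= -compA e1 compm1 comp1m.
Qed.

Lemma yoneda_post X Y (f : hom X Y) :
  (forall Z, bijective (fun h : hom Z X => f \oc h)) -> is_iso f.
Proof.
move=> bf; have [g gK fK] := bf Y.
have e1 : f \oc g (idm Y) = idm Y by exact: fK.
suff e2 : g (idm Y) \oc f = idm X by exists (Iso e2 e1).
by apply: (bij_inj (bf X)); rewrite /= compA e1 compm1 comp1m.
Qed.

End Composition.

Lemma bij_comp_cancelr {A B E : Type} (g : B -> E) (f : A -> B) :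
  bijective f -> bijective (g \o f) -> bijective g.
Proof.
move=> [f' fK f'K] bgf; have bf' : bijective f' by exists f.
by apply: (eq_bij (bij_comp bgf bf')) => x /=; rewrite f'K.
Qed.

Lemma bij_comp_cancell {A B E : Type} (g : B -> E) (f : A -> B) :
  bijective g -> bijective (g \o f) -> bijective f.
Proof.
move=> [g' gK g'K] bgf; have bg' : bijective g' by exists g.
by apply: (eq_bij (bij_comp bg' bgf)) => x /=; rewrite gK.
Qed.

Section FunctorIso.
Context {k : fieldType} {C D : lincat k}.
Variable G : functor C D.

Fact fmap_iso_subproof X Y (i : iso X Y) :
  fmap G (isoi i) \oc fmap G (isoh i) = idm (G X) /\
  fmap G (isoh i) \oc fmap G (isoi i) = idm (G Y).
Proof. by rewrite -!fmapM isohK isoiK !fmap1. Qed.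

Definition fmap_iso X Y (i : iso X Y) : iso (G X) (G Y) :=
  Iso (fmap_iso_subproof i).1 (fmap_iso_subproof i).2.

End FunctorIso.

Section Adjunction.
Context {k : fieldType} {C D : lincat k}.
Variables (L : functor D C) (R : functor C D) (a : adjunction L R).

Lemma adjT_bij V X :
  bijective (fun h : hom (L V) X => fmap R h \oc adj_unit a V).
Proof.
exists (fun h => adj_counit a X \oc fmap L h) => h.
  by rewrite fmapM compA adj_counit_nat -compA adj_triangleL compm1.
by rewrite fmapM -compA -adj_unit_nat compA adj_triangleR comp1m.
Qed.

Lemma adjTi_bij V X :
  bijective (fun h : hom V (R X) => adj_counit a X \oc fmap L h).
Proof.
exists (fun h => fmap R h \oc adj_unit a V) => h.
  by rewrite fmapM -compA -adj_unit_nat compA adj_triangleR comp1m.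
by rewrite fmapM compA adj_counit_nat -compA adj_triangleL compm1.
Qed.

Lemma adjT_inj V X (f g : hom (L V) X) :
  fmap R f \oc adj_unit a V = fmap R g \oc adj_unit a V -> f = g.
Proof. by move=> e; apply: (bij_inj (adjT_bij V X)). Qed.

Lemma adjTK V X (h : hom V (R X)) :
  fmap R (adj_counit a X \oc fmap L h) \oc adj_unit a V = h.
Proof. by rewrite fmapM -compA -adj_unit_nat compA adj_triangleR comp1m. Qed.

End Adjunction.

(** * Coherence in monoidal categories *)

Section Monoidal.
Context {k : fieldType} {M : monoidalCategory k}.
Implicit Types V W X Y Z : M.

Lemma tcomp X X' X'' Y Y' Y'' (f' : hom X' X'') (f : hom X X')
    (g' : hom Y' Y'') (g : hom Y Y') :
  (f' ⊗m g') \oc (f ⊗m g) = (f' \oc f) ⊗m (g' \oc g).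
Proof. by rewrite tensmM. Qed.

Lemma tens_compl X X' X'' Y (g : hom X' X'') (f : hom X X') :
  (g \oc f) ⊗m idm Y = (g ⊗m idm Y) \oc (f ⊗m idm Y).
Proof. by rewrite tcomp comp1m. Qed.

Lemma tens_compr X Y Y' Y'' (g : hom Y' Y'') (f : hom Y Y') :
  idm X ⊗m (g \oc f) = (idm X ⊗m g) \oc (idm X ⊗m f).
Proof. by rewrite tcomp comp1m. Qed.

Lemma tens_lr X X' Y Y' (f : hom X X') (g : hom Y Y') :
  (f ⊗m idm Y') \oc (idm X ⊗m g) = f ⊗m g.
Proof. by rewrite tcomp comp1m compm1. Qed.

Lemma tens_rl X X' Y Y' (f : hom X X') (g : hom Y Y') :
  (idm X' ⊗m g) \oc (f ⊗m idm Y) = f ⊗m g.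
Proof. by rewrite tcomp comp1m compm1. Qed.

Fact tens_iso_subproof X X' Y Y' (i : iso X X') (j : iso Y Y') :
  (isoi i ⊗m isoi j) \oc (isoh i ⊗m isoh j) = idm (X ⊗ Y) /\
  (isoh i ⊗m isoh j) \oc (isoi i ⊗m isoi j) = idm (X' ⊗ Y').
Proof. by rewrite !tcomp !isohK !isoiK !tensm1. Qed.

Definition tens_iso X X' Y Y' (i : iso X X') (j : iso Y Y') :
    iso (X ⊗ Y) (X' ⊗ Y') :=
  Iso (tens_iso_subproof i j).1 (tens_iso_subproof i j).2.

Lemma massoci_nat X X' Y Y' Z Z' (f : hom X X') (g : hom Y Y') (h : hom Z Z') :
  isoi (massoc X' Y' Z') \oc (f ⊗m (g ⊗m h))
    = ((f ⊗m g) ⊗m h) \oc isoi (massoc X Y Z).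
Proof.
apply: (isoh_inj (i := massoc X' Y' Z')).
by rewrite !compA isoiK comp1m massoc_nat isoiKc.
Qed.

Lemma luniti_nat X X' (f : hom X X') :
  isoi (lunit X') \oc f = (idm (munit M) ⊗m f) \oc isoi (lunit X).
Proof.
by apply: (isoh_inj (i := lunit X')); rewrite !compA isoiK comp1m lunit_nat isoiKc.
Qed.

Lemma runiti_nat X X' (f : hom X X') :
  isoi (runit X') \oc f = (f ⊗m idm (munit M)) \oc isoi (runit X).
Proof.
by apply: (isoh_inj (i := runit X')); rewrite !compA isoiK comp1m runit_nat isoiKc.
Qed.

Lemma tens_unitr_inj X Y (f g : hom X Y) :
  f ⊗m idm (munit M) = g ⊗m idm (munit M) -> f = g.
Proof.
by move=> e; apply: (isoh_injr (i := runit X)); rewrite -!runit_nat e.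
Qed.

Lemma trianglei X Y :
  isoh (massoc X (munit M) Y) \oc (isoi (runit X) ⊗m idm Y)
    = idm X ⊗m isoi (lunit Y).
Proof.
apply: (isoh_inj (i := tens_iso (iso_id X) (lunit Y))) => /=.
by rewrite compA triangle !tcomp !comp1m !isoiK.
Qed.

(** Kelly's coherence: after tensoring with the unit, which is faithful, it follows
from the pentagon with two units on the right and two uses of the triangle. *)
Lemma runit_tens X Y :
  isoh (runit (X ⊗ Y))
    = (idm X ⊗m isoh (runit Y)) \oc isoh (massoc X Y (munit M)).
Proof.
apply: tens_unitr_inj.
apply: (isoh_inj (i := massoc X Y (munit M))).
rewrite -triangle compA -(tensm1 X Y) massoc_nat.
rewrite (comp_rw2 (pentagon _ _ _ _)) !compA tcomp comp1m triangle.
by rewrite -massoc_nat -compA tcomp comp1m.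
Qed.

End Monoidal.

Section Reverse.
Context {k : fieldType} (M : monoidalCategory k).
Implicit Types W X Y Z : M.

Fact rev_pentagon W X Y Z :
  isoi (massoc (Z ⊗ Y) X W) \oc isoi (massoc Z Y (X ⊗ W))
    = (isoi (massoc Z Y X) ⊗m idm W) \oc isoi (massoc Z (Y ⊗ X) W)
      \oc (idm Z ⊗m isoi (massoc Y X W)).
Proof.
have := @iso_inv_eq _ _ _ _
  (iso_trans (massoc (Z ⊗ Y) X W) (massoc Z Y (X ⊗ W)))
  (iso_trans (tens_iso (massoc Z Y X) (iso_id W))
    (iso_trans (massoc Z (Y ⊗ X) W) (tens_iso (iso_id Z) (massoc Y X W)))).
by rewrite /= compA; apply; apply: pentagon.
Qed.

Fact rev_triangle X Y :
  (isoh (runit Y) ⊗m idm X) \oc isoi (massoc Y (munit M) X)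
    = idm Y ⊗m isoh (lunit X).
Proof. by rewrite -triangle isoiKc. Qed.

(** The same category with [X ⊗ Y] replaced by [Y ⊗ X]: a lemma about right
tensoring applied to it is the mirror lemma about left tensoring. *)
Definition rev_monoidal : monoidalCategory k :=
  @MonoidalCategory k M (fun X Y => Y ⊗ X) (fun _ _ _ _ f g => g ⊗m f)
    (munit M) (fun X Y Z => iso_sym (massoc Z Y X)) (fun X => runit X)
    (fun X => lunit X) (fun X Y => tensm1 Y X)
    (fun _ _ _ _ _ _ f' f g' g => tensmM g' g f' f)
    (fun _ _ _ _ _ _ f g h => massoci_nat h g f)
    (fun _ _ f => runit_nat f) (fun _ _ f => lunit_nat f)
    rev_pentagon rev_triangle.

End Reverse.

Section Units.
Context {k : fieldType} {M : monoidalCategory k}.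
Implicit Types X Y : M.

Lemma lunit_tens X Y :
  isoh (lunit (X ⊗ Y)) \oc isoh (massoc (munit M) X Y) = isoh (lunit X) ⊗m idm Y.
Proof. by have /= -> := @runit_tens _ (rev_monoidal M) Y X; rewrite isohKc. Qed.

Lemma luniti_tens X Y :
  isoi (lunit (X ⊗ Y))
    = isoh (massoc (munit M) X Y) \oc (isoi (lunit X) ⊗m idm Y).
Proof.
apply: (isoh_inj (i := lunit (X ⊗ Y))).
by rewrite isoiK compA lunit_tens tcomp isoiK comp1m tensm1.
Qed.

Lemma runiti_tens X Y :
  isoi (runit (X ⊗ Y))
    = isoi (massoc X Y (munit M)) \oc (idm X ⊗m isoi (runit Y)).
Proof.
apply: (isoh_inj (i := runit (X ⊗ Y))).
by rewrite isoiK runit_tens compA isoiKc tcomp isoiK comp1m tensm1.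
Qed.

Lemma lunit_unit : isoh (lunit (munit M)) = isoh (runit (munit M)).
Proof.
apply: tens_unitr_inj; rewrite -triangle -lunit_tens; congr (_ \oc _).
by apply: (isoh_inj (i := lunit (munit M))); rewrite lunit_nat.
Qed.

Lemma luniti_unit : isoi (lunit (munit M)) = isoi (runit (munit M)).
Proof. exact: iso_inv_eq lunit_unit. Qed.

End Units.

(** * Duality *)

Section Duality.
Context {k : fieldType} {M : monoidalCategory k}.

Record dual_pair (Y' Y : M) := DualPair {
  ev : hom (Y' ⊗ Y) (munit M);
  coev : hom (munit M) (Y ⊗ Y');
  dual_zig : isoh (runit Y) \oc (idm Y ⊗m ev) \oc isoh (massoc Y Y' Y)
      \oc (coev ⊗m idm Y) = isoh (lunit Y);
  dual_zag : isoh (lunit Y') \oc (ev ⊗m idm Y') \oc isoi (massoc Y' Y Y')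
      \oc (idm Y' ⊗m coev) = isoh (runit Y')
}.

Lemma left_dual_pair (Y' Y : M) : left_dual Y' Y -> inhabited (dual_pair Y' Y).
Proof. by case=> e [c [zig zag]]; split; exists e c. Qed.

Variables (Y' Y : M) (d : dual_pair Y' Y).
Implicit Types V W X Z : M.

(** Counit and unit of the adjunction between [- ⊗ Y] and [- ⊗ Y']. *)
Definition evr Z : hom ((Z ⊗ Y') ⊗ Y) Z :=
  locked (isoh (runit Z) \oc (idm Z ⊗m ev d) \oc isoh (massoc Z Y' Y)).

Definition coevr Z : hom Z ((Z ⊗ Y) ⊗ Y') :=
  locked (isoi (massoc Z Y Y') \oc (idm Z ⊗m coev d) \oc isoi (runit Z)).

Lemma evrE Z : evr Z
  = isoh (runit Z) \oc (idm Z ⊗m ev d) \oc isoh (massoc Z Y' Y).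
Proof. by rewrite /evr -lock. Qed.

Lemma coevrE Z : coevr Z
  = isoi (massoc Z Y Y') \oc (idm Z ⊗m coev d) \oc isoi (runit Z).
Proof. by rewrite /coevr -lock. Qed.

Lemma evr_nat W Z (f : hom W Z) :
  evr Z \oc ((f ⊗m idm Y') ⊗m idm Y) = f \oc evr W.
Proof.
rewrite !evrE -!compA massoc_nat !compA tensm1; congr (_ \oc _).
by rewrite -compA tens_rl -tens_lr compA runit_nat.
Qed.

Lemma coevr_nat W Z (f : hom W Z) :
  coevr Z \oc f = ((f ⊗m idm Y) ⊗m idm Y') \oc coevr W.
Proof.
rewrite !coevrE -!compA runiti_nat !compA -massoci_nat; congr (_ \oc _).
by rewrite -!compA; congr (_ \oc _); rewrite tens_rl tensm1 tens_lr.
Qed.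

(** The counit commutes with tensoring on the left, so the triangle identity at
[W ⊗ Y] reduces to the zigzag at [Y]. *)
Lemma evr_tens W Z :
  evr (W ⊗ Z) = (idm W ⊗m evr Z) \oc isoh (massoc W (Z ⊗ Y') Y)
    \oc (isoh (massoc W Z Y') ⊗m idm Y).
Proof.
rewrite !evrE runit_tens -tensm1.
rewrite (comp_rw2 (massoc_nat _ _ _)) compA (comp_rw2 (pentagon _ _ _ _)) !compA.
by rewrite !tcomp !comp1m.
Qed.

Lemma evr_coevr W : evr (W ⊗ Y) \oc (coevr W ⊗m idm Y) = idm (W ⊗ Y).
Proof.
have zigl : evr Y \oc (coev d ⊗m idm Y) = isoh (lunit Y).
  by rewrite evrE; apply: dual_zig.
rewrite evr_tens !coevrE -!compA !tcomp comp1m !compA isoiK comp1m.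
rewrite tens_compl compA (comp_rw2 (massoc_nat _ _ _)) compA.
rewrite tcomp comp1m zigl triangle tcomp isoiK comp1m.
by rewrite tensm1.
Qed.

Lemma coevr_evr Z : (evr Z ⊗m idm Y') \oc coevr (Z ⊗ Y') = idm (Z ⊗ Y').
Proof.
have pent : (isoh (massoc Z Y' Y) ⊗m idm Y') \oc isoi (massoc (Z ⊗ Y') Y Y')
   = isoi (massoc Z (Y' ⊗ Y) Y') \oc (idm Z ⊗m isoi (massoc Y' Y Y'))
      \oc isoh (massoc Z Y' (Y ⊗ Y')).
  apply: (isoh_injr (i := massoc (Z ⊗ Y') Y Y')); rewrite isohKc.
  rewrite -!compA pentagon !compA (comp_rw2 (tcomp _ _ _ _)) isohK comp1m.
  by rewrite tensm1 compm1 isohK comp1m.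
rewrite !evrE !tens_compl !coevrE !compA.
rewrite (comp_rw2 pent) !compA -tensm1 (comp_rw2 (massoc_nat _ _ _)) !compA.
rewrite runiti_tens !compA isoiKc.
rewrite -triangle (comp_rw2 (massoc_nat _ _ _)) !compA isoiKc.
by rewrite -!tens_compr dual_zag isoiK.
Qed.

Lemma curry_bij V Z :
  bijective (fun h : hom (V ⊗ Y) Z => (h ⊗m idm Y') \oc coevr V).
Proof.
exists (fun x => evr Z \oc (x ⊗m idm Y)) => h.
  by rewrite tens_compl compA evr_nat -compA evr_coevr compm1.
by rewrite tens_compl -compA -coevr_nat compA coevr_evr comp1m.
Qed.

Lemma uncurry_bij V Z :
  bijective (fun x : hom V (Z ⊗ Y') => evr Z \oc (x ⊗m idm Y)).
Proof.
exists (fun h => (h ⊗m idm Y') \oc coevr V) => h.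
  by rewrite tens_compl -compA -coevr_nat compA coevr_evr comp1m.
by rewrite tens_compl compA evr_nat -compA evr_coevr compm1.
Qed.

Lemma evr_coev : evr Y \oc (coev d ⊗m idm Y) = isoh (lunit Y).
Proof. by rewrite evrE; apply: dual_zig. Qed.

Lemma evr_unit : evr (munit M) \oc (isoi (lunit Y') ⊗m idm Y) = ev d.
Proof.
rewrite !evrE -compA -luniti_tens -compA -luniti_nat compA -lunit_unit isoiK.
by rewrite comp1m.
Qed.

Lemma ev_bij X : bijective (fun y : hom X Y' => ev d \oc (y ⊗m idm Y)).
Proof.
apply: (eq_bij (bij_comp (uncurry_bij X (munit M))
  (bij_postcomp X (iso_sym (lunit Y'))))) => y /=.
by rewrite tens_compl compA evr_unit.
Qed.

Lemma coev_bij Z : bijective (fun g : hom Y Z => (g ⊗m idm Y') \oc coev d).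
Proof.
apply: (@bij_comp_cancell _ _ _
  (fun x => evr Z \oc (x ⊗m idm Y) \oc isoi (lunit Y))).
  exact: bij_comp (bij_precomp Z (iso_sym (lunit Y))) (uncurry_bij _ Z).
exists id => g /=.
all: by rewrite tens_compl compA evr_nat (comp_rw2 evr_coev) isoiKc.
Qed.

(** The form on [Y] named by a global element of its dual. *)
Definition form_of (f : hom (munit M) Y') : hom Y (munit M) :=
  ev d \oc (f ⊗m idm Y) \oc isoi (lunit Y).

Lemma form_of_bij : bijective form_of.
Proof. exact: bij_comp (bij_precomp _ (iso_sym (lunit Y))) (ev_bij _). Qed.

Lemma form_of_coevK (h : hom Y (munit M)) :
  form_of (isoh (lunit Y') \oc (h ⊗m idm Y') \oc coev d) = h.
Proof.
have evl1 : ev d \oc (isoh (lunit Y') ⊗m idm Y) = evr (munit M).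
  by rewrite -evr_unit -compA -tens_compl isohK tensm1 compm1.
rewrite /form_of !tens_compl !compA evl1.
by rewrite evr_nat (comp_rw2 evr_coev) isoiKc.
Qed.

Lemma form_of_coev (f : hom (munit M) Y') :
  isoh (lunit Y') \oc (form_of f ⊗m idm Y') \oc coev d = f.
Proof. by apply: (bij_inj form_of_bij); apply: form_of_coevK. Qed.

End Duality.

Section LeftDuality.
Context {k : fieldType} {M : monoidalCategory k}.
Variables (Y' Y : M) (d : dual_pair Y' Y).
Implicit Types V W X Z : M.

Definition rev_pair : @dual_pair k (rev_monoidal M) Y Y' :=
  @DualPair k (rev_monoidal M) Y Y' (ev d) (coev d) (dual_zag d) (dual_zig d).

Definition coevl : forall Z, hom Z (Y ⊗ (Y' ⊗ Z)) := coevr rev_pair.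

Lemma coevlE Z : coevl Z
  = isoh (massoc Y Y' Z) \oc (coev d ⊗m idm Z) \oc isoi (lunit Z).
Proof. exact: (coevrE rev_pair). Qed.

Lemma curryl_bij V Z :
  bijective (fun h : hom (Y' ⊗ V) Z => (idm Y ⊗m h) \oc coevl V).
Proof. exact: (curry_bij rev_pair). Qed.

Lemma evl_bij X : bijective (fun y : hom X Y => ev d \oc (idm Y' ⊗m y)).
Proof. exact: (ev_bij rev_pair). Qed.

Lemma coevl_bij Z : bijective (fun g : hom Y' Z => (idm Y ⊗m g) \oc coev d).
Proof. exact: (coev_bij rev_pair). Qed.

(** A zigzag identity into which [f] has been inserted; it cancels the coevaluation
that [copair] introduces. *)
Lemma form_of_coevl V (f : hom (munit M) Y') :
  isoh (lunit (Y' ⊗ V)) \oc (form_of d f ⊗m idm (Y' ⊗ V)) \oc coevl V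
    = (f ⊗m idm V) \oc isoi (lunit V).
Proof.
rewrite coevlE !compA; congr (_ \oc _).
rewrite -tensm1 (comp_rw2 (esym (massoc_nat _ _ _))) !compA lunit_tens.
by rewrite -!tens_compl form_of_coev.
Qed.

End LeftDuality.

(** * Reversed tensor functors and images of duals *)

Section ReverseTensor.
Context {k : fieldType}.

Fact rev_bilinear (M : monoidalCategory k) :
  tensor_bilinear M -> tensor_bilinear (rev_monoidal M).
Proof. by case=> bl br; split=> *; [apply: br | apply: bl]. Qed.

Fact rev_left_dual (M : monoidalCategory k) (Y' Y : M) :
  left_dual Y' Y -> @left_dual k (rev_monoidal M) Y Y'.
Proof. by case=> e [c [zig zag]]; exists e, c. Qed.

Fact rev_rigid (M : monoidalCategory k) : rigid M -> rigid (rev_monoidal M).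
Proof.
move=> rM X; have [[Y dY] [Z dZ]] := rM X.
by split; [exists Z | exists Y]; apply: rev_left_dual.
Qed.

Definition rev_tensor (C : tensorCategory k) : tensorCategory k :=
  @TensorCategory k (rev_monoidal C) (tcat_abelian C)
    (rev_bilinear (tcat_bilinear C)) (rev_rigid (@tcat_rigid k C)).

Context {C D : tensorCategory k} (F : tensorFunctor C D).

Lemma tfun2_massoci (X Y Z : C) :
  fmap F (isoi (massoc X Y Z)) \oc isoh (tfun2 F X (Y ⊗ Z))
      \oc (idm (F X) ⊗m isoh (tfun2 F Y Z))
    = isoh (tfun2 F (X ⊗ Y) Z) \oc (isoh (tfun2 F X Y) ⊗m idm (F Z))
      \oc isoi (massoc (F X) (F Y) (F Z)).
Proof.
apply: (isoh_inj (i := fmap_iso F (massoc X Y Z))).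
apply: (isoh_injr (i := massoc (F X) (F Y) (F Z))).
by rewrite !compA isohKc tfun2_assoc isoiK comp1m.
Qed.

Definition rev_functor : tensorFunctor (rev_tensor C) (rev_tensor D) :=
  @TensorFunctor k (rev_tensor C) (rev_tensor D) F (@tfun_linear _ _ _ F)
    (tfun0 F) (fun X Y => tfun2 F Y X)
    (fun _ _ _ _ f g => tfun2_nat F g f)
    (fun X Y Z => tfun2_massoci Z Y X)
    (@tfun_runit _ _ _ F) (@tfun_lunit _ _ _ F).

End ReverseTensor.

Section DualImage.
Context {k : fieldType}.

Definition fev (C D : tensorCategory k) (F : tensorFunctor C D) (Y' Y : C)
    (d : dual_pair Y' Y) : hom (F Y' ⊗ F Y) (munit D) :=
  isoi (tfun0 F) \oc fmap F (ev d) \oc isoh (tfun2 F Y' Y).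

Definition fcoev (C D : tensorCategory k) (F : tensorFunctor C D) (Y' Y : C)
    (d : dual_pair Y' Y) : hom (munit D) (F Y ⊗ F Y') :=
  isoi (tfun2 F Y Y') \oc fmap F (coev d) \oc isoh (tfun0 F).

(** Stated with [F ev] spelled out because it is what proves that the image of a
dual pair is a dual pair. *)
Fact fmap_evr_subproof (C D : tensorCategory k) (F : tensorFunctor C D)
    (Y' Y : C) (d : dual_pair Y' Y) (Z : C) :
  fmap F (evr d Z) \oc isoh (tfun2 F (Z ⊗ Y') Y)
      \oc (isoh (tfun2 F Z Y') ⊗m idm (F Y))
    = isoh (runit (F Z)) \oc (idm (F Z) ⊗m fev F d)
      \oc isoh (massoc (F Z) (F Y') (F Y)).
Proof.
rewrite evrE !fmapM (comp_rw3 (tfun2_assoc _ _ _ _)) !compA.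
congr (_ \oc _); rewrite (comp_rw2 (esym (tfun2_nat _ _ _))) !compA fmap1.
rewrite /fev -tfun_runit !tens_compr !compA; congr (_ \oc _ \oc _).
by rewrite -compA -tens_compr isoiK tensm1 compm1.
Qed.

(** Both zigzags of the image pair are instances of this one: the second is the
first for the reversed functor. *)
Fact fmap_zig (C D : tensorCategory k) (F : tensorFunctor C D)
    (Y' Y : C) (d : dual_pair Y' Y) :
  isoh (runit (F Y)) \oc (idm (F Y) ⊗m fev F d)
      \oc isoh (massoc (F Y) (F Y') (F Y)) \oc (fcoev F d ⊗m idm (F Y))
    = isoh (lunit (F Y)).
Proof.
rewrite -fmap_evr_subproof /fcoev !tens_compl !compA.
rewrite (comp_rw2 (esym (tens_compl _ (isoh _) (isoi _)))) isoiK tensm1 compm1.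
rewrite -fmap1.
rewrite (comp_rw2 (tfun2_nat _ _ _)) compA -fmapM evr_coev fmap1.
exact: tfun_lunit.
Qed.

Context {C D : tensorCategory k} (F : tensorFunctor C D).
Variables (Y' Y : C) (d : dual_pair Y' Y).

Definition fmap_pair : dual_pair (F Y') (F Y) :=
  DualPair (fmap_zig F d) (fmap_zig (rev_functor F) (rev_pair d)).

Lemma fmap_evr (Z : C) :
  fmap F (evr d Z) \oc isoh (tfun2 F (Z ⊗ Y') Y)
      \oc (isoh (tfun2 F Z Y') ⊗m idm (F Y)) = evr fmap_pair (F Z).
Proof. by rewrite [RHS]evrE; apply: fmap_evr_subproof. Qed.

End DualImage.

(** * The projection formula *)

Section Projection.
Context {k : fieldType} {C D : tensorCategory k} (F : tensorFunctor C D).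
Variables (L : functor D C) (adjL : adjunction L F).
Local Notation eta := (adj_unit adjL).
Local Notation eps := (adj_counit adjL).

(** The transpose of [V ⊗ F X -> F (L V) ⊗ F X ≅ F (L V ⊗ X)]. *)
Definition proj (V : D) (X : C) : hom (L (V ⊗ F X)) (L V ⊗ X) :=
  locked (eps _ \oc fmap L (isoh (tfun2 F (L V) X) \oc (eta V ⊗m idm (F X)))).

Lemma projE V X : fmap F (proj V X) \oc eta (V ⊗ F X)
  = isoh (tfun2 F (L V) X) \oc (eta V ⊗m idm (F X)).
Proof. by rewrite /proj -lock adjTK. Qed.

Lemma proj_nat V V' X X' (f : hom V V') (g : hom X X') :
  proj V' X' \oc fmap L (f ⊗m fmap F g) = (fmap L f ⊗m g) \oc proj V X.
Proof.
apply: (adjT_inj (a := adjL)); rewrite !fmapM -!compA -adj_unit_nat !compA !projE.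
rewrite (comp_rw2 (projE _ _)) compA -tfun2_nat -!compA !tcomp adj_unit_nat.
by rewrite comp1m compm1.
Qed.

Lemma proj_transpose V X Z (h : hom (L V ⊗ X) Z) :
  fmap F (h \oc proj V X) \oc eta (V ⊗ F X)
    = fmap F h \oc isoh (tfun2 F (L V) X) \oc (eta V ⊗m idm (F X)).
Proof. by rewrite fmapM -compA projE compA. Qed.

(** By Yoneda: maps [L V ⊗ X -> Z] are maps [L V -> Z ⊗ X'], hence maps
[V -> F Z ⊗ F X'], hence maps [V ⊗ F X -> F Z], because [F X'] is dual to [F X]. *)
Lemma proj_iso V X : is_iso (proj V X).
Proof.
apply: yoneda_pre => Z.
have [[X' /left_dual_pair[d]] _] := tcat_rigid X.
apply: (bij_comp_cancelr (uncurry_bij d (L V) Z)).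
apply: (bij_comp_cancell (adjT_bij adjL _ _)).
pose i := iso_sym (tfun2 F Z X').
have b := bij_comp (uncurry_bij (fmap_pair F d) V (F Z))
  (bij_comp (bij_postcomp V i) (adjT_bij adjL _ _)).
apply: (eq_bij b) => x /=.
rewrite proj_transpose fmapM -fmap_evr -!compA; congr (_ \oc _).
rewrite -!tens_compl !compA isoiK comp1m.
by rewrite tens_compl -tfun2_nat fmap1 compA.
Qed.

(** Across the projection formulas for [Y'] and [Y], the evaluation of the image pair
agrees with that of the pair itself.  This identifies the map that [universal_at]
shows to be bijective. *)
Lemma proj_evr (Y' Y : C) (d : dual_pair Y' Y) (W : D) :
  evr d (L W) \oc (proj W Y' ⊗m idm Y) \oc proj (W ⊗ F Y') Y
    = fmap L (evr (fmap_pair F d) W).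
Proof.
apply: (adjT_inj (a := adjL)).
rewrite proj_transpose -adj_unit_nat fmapM -!compA.
rewrite (compA (fmap F (_ ⊗m _))) -tfun2_nat -compA fmap1 -tens_compl projE.
by rewrite tens_compl !compA fmap_evr evr_nat.
Qed.

End Projection.

Section LeftProjection.
Context {k : fieldType} {C D : tensorCategory k} (F : tensorFunctor C D).
Variables (L : functor D C) (adjL : adjunction L F).
Local Notation eta := (adj_unit adjL).

Definition projl (V : D) (X : C) : hom (L (F X ⊗ V)) (X ⊗ L V) :=
  @proj k (rev_tensor C) (rev_tensor D) (rev_functor F) L adjL V X.

Lemma projlE V X : fmap F (projl V X) \oc eta (F X ⊗ V)
  = isoh (tfun2 F X (L V)) \oc (idm (F X) ⊗m eta V).
Proof. exact: (@projE k (rev_tensor C) (rev_tensor D) (rev_functor F)). Qed.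

Lemma projl_nat V V' X X' (f : hom V V') (g : hom X X') :
  projl V' X' \oc fmap L (fmap F g ⊗m f) = (g ⊗m fmap L f) \oc projl V X.
Proof. exact: (@proj_nat k (rev_tensor C) (rev_tensor D) (rev_functor F)). Qed.

Lemma projl_iso V X : is_iso (projl V X).
Proof. exact: (@proj_iso k (rev_tensor C) (rev_tensor D) (rev_functor F)). Qed.

End LeftProjection.

(** * Universal arrows and one-sided invertibility *)

Section Universal.
Context {k : fieldType} {C D : lincat k} (L : functor D C).

Definition universal_arrow (X : C) (V : D) (u : hom X (L V)) : Prop :=
  forall W, bijective (fun f : hom V W => fmap L f \oc u).

Lemma universal_iso X V V' (u : hom X (L V)) (u' : hom X (L V')) :
  universal_arrow u -> universal_arrow u' ->
  exists i : iso V V', fmap L (isoh i) \oc u = u'.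
Proof.
move=> uU uU'; have [g _ /(_ u') /= gu] := uU V'; set f := g u' in gu.
suff [i ei] : is_iso f by exists i; rewrite ei.
apply: yoneda_pre => W; apply: (bij_comp_cancell (uU W)).
by apply: (eq_bij (uU' W)) => h /=; rewrite fmapM -compA gu.
Qed.

End Universal.

Section Represent.
Context {k : fieldType} {C D : tensorCategory k} (F : tensorFunctor C D).
Variables (L : functor D C) (adjL : adjunction L F) (chi : D).
Variables (u : hom (munit C) (L chi)) (uU : universal_arrow u).
Local Notation eta := (adj_unit adjL).
Local Notation eps := (adj_counit adjL).
Local Notation proj := (proj adjL).

(** Maps out of [chi ⊗ F X] are maps out of [chi] into [W ⊗ F X'], where the
universal property of [u] applies, and [L(W ⊗ F X') ≅ L W ⊗ X']. *)
Lemma universal_at X : exists v : hom X (L (chi ⊗ F X)),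
  proj chi X \oc v = (u ⊗m idm X) \oc isoi (lunit X) /\ universal_arrow v.
Proof.
have [p ep] := proj_iso adjL chi X.
exists (isoi p \oc (u ⊗m idm X) \oc isoi (lunit X)); split.
  by rewrite -ep !compA isoiK comp1m.
move=> W; have [[X' /left_dual_pair[d]] _] := tcat_rigid X.
apply: (bij_comp_cancelr (uncurry_bij (fmap_pair F d) chi W)).
have [q eq] := proj_iso adjL W X'.
have b := bij_comp (bij_precomp _ (iso_sym (lunit X)))
 (bij_comp (uncurry_bij d _ (L W)) (bij_comp (bij_postcomp _ q) (uU _))).
apply: (eq_bij b) => x /=.
have key : proj (W ⊗ F X') X \oc fmap L (x ⊗m idm (F X)) \oc isoi p
    = fmap L x ⊗m idm X.
  by rewrite -[idm (F X)]fmap1 proj_nat -ep isoiKc.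
by rewrite eq fmapM -(proj_evr adjL) !tens_compl !compA (comp_rw3 key).
Qed.

Section Copairing.
Variables (W W' : D) (d : dual_pair W W').

(** The copairing that exhibits [L(W ⊗ chi)] as a dual of [L W']: start from [u],
insert the coevaluation of [W], and split [L(W' ⊗ (W ⊗ chi))]. *)
Definition copair : hom (munit C) (L W' ⊗ L (W ⊗ chi)) :=
  locked (proj W' (L (W ⊗ chi))
    \oc fmap L ((idm W' ⊗m eta (W ⊗ chi)) \oc coevl d chi) \oc u).

Lemma copair_proj Z (h : hom (L (W ⊗ chi)) Z) :
  (idm (L W') ⊗m h) \oc copair
    = proj W' Z \oc (fmap L ((idm W' ⊗m (fmap F h \oc eta (W ⊗ chi)))
        \oc coevl d chi) \oc u).
Proof.
rewrite /copair -lock !compA -(fmap1 L) -proj_nat; congr (_ \oc _).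
by rewrite -compA -fmapM compA -tens_compr.
Qed.

Lemma copair_universal Z :
  bijective (fun h : hom (L (W ⊗ chi)) Z => (idm (L W') ⊗m h) \oc copair).
Proof.
have [p ep] := proj_iso adjL W' Z.
have b := bij_comp (bij_postcomp _ p) (bij_comp (uU _)
  (bij_comp (curryl_bij d chi (F Z)) (adjT_bij adjL _ Z))).
by apply: (eq_bij b) => h /=; rewrite copair_proj ep.
Qed.

(** A dual of [L W'] also exists by rigidity, and the two copairings are matched by
an isomorphism, so the usual bijection for duals transports. *)
Lemma copair_form_bij :
  bijective (fun g : hom (L W') (munit C) =>
    isoh (lunit (L (W ⊗ chi))) \oc (g ⊗m idm _) \oc copair).
Proof.
have [[A' /left_dual_pair[e]] _] := tcat_rigid (L W').
have [h _ /(_ copair)] := coevl_bij e (L (W ⊗ chi)).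
set t := h copair => /= et.
have [i ei] : is_iso t.
  apply: yoneda_pre => Z; apply: (bij_comp_cancell (coevl_bij e Z)).
  apply: (eq_bij (copair_universal Z)) => f /=.
  by rewrite -et compA -tens_compr.
have b := bij_comp (bij_postcomp _ i) (bij_comp (bij_postcomp _ (lunit A'))
   (coev_bij e (munit C))).
apply: (eq_bij b) => g /=.
rewrite ei -et !compA -lunit_nat.
by rewrite (comp_rw2 (tens_lr _ _)) (comp_rw2 (tens_rl _ _)).
Qed.

End Copairing.

(** Writing [f : 1 -> W] as a form on [W'] and contracting the copairing against the
induced form on [L W'] removes the inserted coevaluation and leaves [f ⊗ chi]. *)
Lemma twist_bij W : bijective (fun f : hom (munit D) W =>
  fmap L ((f ⊗m idm chi) \oc isoi (lunit chi)) \oc u).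
Proof.
have [_ [W' /left_dual_pair[d]]] := tcat_rigid W.
have b := bij_comp (copair_form_bij d) (bij_comp (adjTi_bij adjL _ _)
  (bij_comp (bij_postcomp _ (tfun0 F)) (form_of_bij d))).
apply: (eq_bij b) => f /=; set g := eps _ \oc _.
rewrite -(form_of_coevl d).
(* the form g on L W' is transposed to the form on W' named by f *)
have gp : isoh (lunit (L (W ⊗ chi))) \oc (g ⊗m idm _) \oc proj W' (L (W ⊗ chi))
    = eps _ \oc fmap L (isoh (lunit _) \oc (form_of d f ⊗m idm _)).
  apply: (adjT_inj (a := adjL)); rewrite adjTK proj_transpose fmapM -tfun_lunit.
  rewrite (comp_rw2 (esym (tfun2_nat _ _ _))) !compA fmap1.
  by rewrite (comp_rw2 (esym (tens_compl _ _ _))) adjTK tens_compl !compA.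
have slide : isoh (lunit _) \oc (form_of d f ⊗m idm _)
      \oc ((idm W' ⊗m eta (W ⊗ chi)) \oc coevl d chi)
    = eta (W ⊗ chi) \oc (isoh (lunit _) \oc (form_of d f ⊗m idm _) \oc coevl d chi).
  rewrite !compA -lunit_nat (comp_rw2 (tens_lr _ _)) (comp_rw2 (tens_rl _ _)).
  by [].
rewrite /copair -lock !compA gp (comp_rw2 (esym (fmapM L _ _))) slide.
by rewrite fmapM compA adj_triangleL comp1m.
Qed.

Lemma ev_iso (chi' : D) (d : dual_pair chi chi') : is_iso (ev d).
Proof.
apply: yoneda_pre => W.
have b : bijective (fun f : hom (munit D) W => (f ⊗m idm chi) \oc isoi (lunit chi)).
  exact: (bij_comp_cancell (uU _) (twist_bij W)).
apply: (eq_bij (bij_comp (uncurry_bij d _ W) b)) => f /=.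
by rewrite tens_compl compA evr_nat -compA evr_unit.
Qed.

Lemma tens_fully_faithful V W :
  bijective (fun f : hom V W => f ⊗m idm chi).
Proof.
have [_ [chi' /left_dual_pair[d]]] := tcat_rigid chi.
apply: (bij_comp_cancell (uncurry_bij d _ W)).
have [i ei] := ev_iso d.
pose j := iso_trans (massoc V chi chi')
  (iso_trans (tens_iso (iso_id V) i) (runit V)).
by apply: (eq_bij (bij_precomp W j)) => f /=; rewrite evr_nat evrE ei !compA.
Qed.

End Represent.

(** * Invertibility and the isomorphism between [R] and [L(- ⊗ chi)] *)

Lemma dependent_choice (A : Type) (B : A -> Type)
    (P : forall x, B x -> Prop) :
  (forall x, exists y, P x y) -> exists f : forall x, B x, forall x, P x (f x).
Proof.
move=> h; exists (fun x => proj1_sig (constructive_indefinite_description _ (h x))).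
by move=> x; case: constructive_indefinite_description.
Qed.

Section Isomorphic.
Context {k : fieldType}.

Lemma isomorphic_sym (C : lincat k) (X Y : C) : isomorphic X Y -> isomorphic Y X.
Proof. by case=> i; split; apply: iso_sym. Qed.

Lemma isomorphic_trans (C : lincat k) (X Y Z : C) :
  isomorphic X Y -> isomorphic Y Z -> isomorphic X Z.
Proof. by move=> [i] [j]; split; apply: iso_trans i j. Qed.

Lemma isomorphic_tens (M : monoidalCategory k) (X X' Y Y' : M) :
  isomorphic X X' -> isomorphic Y Y' -> isomorphic (X ⊗ Y) (X' ⊗ Y').
Proof. by move=> [i] [j]; split; apply: tens_iso. Qed.

(** A left and a right inverse agree; one of them alone need not be two-sided when
the unit is not simple. *)
Lemma invertible_of_onesided (M : monoidalCategory k) (X Y Z : M) :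
  isomorphic (X ⊗ Y) (munit M) -> isomorphic (Z ⊗ X) (munit M) -> invertible X.
Proof.
move=> XY ZX; exists Y; split=> //.
have ZY : isomorphic Z Y.
  apply: (isomorphic_trans (Y := Z ⊗ munit M)).
    by split; apply: iso_sym (runit Z).
  apply: (isomorphic_trans (Y := Z ⊗ (X ⊗ Y))).
    by apply: isomorphic_tens (isomorphic_sym XY); split; apply: iso_id.
  apply: (isomorphic_trans (Y := munit M ⊗ Y)); last by split; apply: lunit.
  apply: (isomorphic_trans (Y := (Z ⊗ X) ⊗ Y)).
    by split; apply: iso_sym (massoc Z X Y).
  by apply: isomorphic_tens => //; split; apply: iso_id.
apply: isomorphic_trans ZX; apply: isomorphic_tens (isomorphic_sym ZY) _.
by split; apply: iso_id.
Qed.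

End Isomorphic.

Section Consequences.
Context {k : fieldType} {C D : tensorCategory k} (F : tensorFunctor C D).
Variables (L : functor D C) (adjL : adjunction L F) (chi : D).
Variables (u : hom (munit C) (L chi)) (uU : universal_arrow u).
Local Notation eta := (adj_unit adjL).
Local Notation proj := (proj adjL).
Local Notation projl := (projl adjL).

Lemma universal_atl X : exists v : hom X (L (F X ⊗ chi)),
  projl chi X \oc v = (idm X ⊗m u) \oc isoi (runit X) /\ universal_arrow v.
Proof.
exact: (@universal_at k (rev_tensor C) (rev_tensor D) (rev_functor F) L adjL
  chi u uU X).
Qed.

(** The reversed functor has the same [u], and there the evaluation of a left dual
of [chi] becomes that of a right dual. *)
Lemma represent_invertible : invertible chi.
Proof.
have [[Z /left_dual_pair[dZ]] [Y /left_dual_pair[dY]]] := tcat_rigid chi.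
have [i _] := ev_iso adjL uU dY.
have [j _] := @ev_iso k (rev_tensor C) (rev_tensor D) (rev_functor F) L adjL
  chi u uU Z (rev_pair dZ).
by apply: (@invertible_of_onesided _ _ _ Y Z); split.
Qed.

Lemma represent_relative_modular (R : functor D C) (adjR : adjunction F R) :
  relative_modular_object L R chi.
Proof.
have [v vP] := dependent_choice universal_atl.
have v_nat X Y (f : hom X Y) :
    fmap L (fmap F f ⊗m idm chi) \oc v X = v Y \oc f.
  have [p ep] := projl_iso adjL chi Y.
  apply: (isoh_inj (i := p)); rewrite ep !compA projl_nat (vP Y).1.
  rewrite -compA (vP X).1 -compA runiti_nat !compA fmap1.
  by rewrite tens_lr tens_rl.
(* the comparison map that uniqueness of right adjoints suggests *)
pose m V : hom (R V) (L (V ⊗ chi)) :=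
  fmap L (adj_counit adjR V ⊗m idm chi) \oc v (R V).
have mP V X (f : hom X (R V)) :
    m V \oc f = fmap L ((adj_counit adjR V \oc fmap F f) ⊗m idm chi) \oc v X.
  by rewrite /m -compA -v_nat compA -fmapM -tens_compl.
have m_iso V : is_iso (m V).
  apply: yoneda_post => X.
  have b := bij_comp ((vP X).2 (V ⊗ chi)) (bij_comp (tens_fully_faithful adjL uU _ _)
    (adjTi_bij adjR X V)).
  by apply: (eq_bij b) => f /=; rewrite mP.
have [i ei] := dependent_choice m_iso.
split; exists i => V W f /=.
by rewrite !ei mP adj_counit_nat tens_compl fmapM -!compA.
Qed.

(** * The half-braiding of [chi] *)

(** [t] is [s] read through the projection formulas (see [matesP]).  This form
is obtained by transposing along the adjunction and applies [F] alone, so that its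
stability under tensor products is a diagram chase with the structure of [F]. *)
Definition mates X Y (s : hom (chi ⊗ F X) (F Y ⊗ chi))
    (t : hom (L chi ⊗ X) (Y ⊗ L chi)) : Prop :=
  fmap F t \oc isoh (tfun2 F (L chi) X) \oc (eta chi ⊗m idm (F X))
    = isoh (tfun2 F Y (L chi)) \oc (idm (F Y) ⊗m eta chi) \oc s.

Lemma matesP X Y s t :
  @mates X Y s t <-> t \oc proj chi X = projl chi Y \oc fmap L s.
Proof.
rewrite /mates; split=> [e|e].
  apply: (adjT_inj (a := adjL)).
  rewrite proj_transpose e fmapM -(compA (fmap F (projl _ _))) -adj_unit_nat.
  by rewrite compA projlE.
by rewrite -proj_transpose e fmapM -compA -adj_unit_nat compA projlE.
Qed.

(** [s] is determined by [L s] on the universal arrow [X -> L(chi ⊗ F X)], which the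
projection formula turns into the value of [t] on [u]. *)
Lemma mates_uniq X Y s s' t t' :
  @mates X Y s t -> @mates X Y s' t' ->
  t \oc (u ⊗m idm X) \oc isoi (lunit X) = t' \oc (u ⊗m idm X) \oc isoi (lunit X) ->
  s = s'.
Proof.
move=> /matesP c /matesP c' e; have [v [pv vU]] := universal_at adjL uU X.
have [p ep] := projl_iso adjL chi Y.
apply: (bij_inj (vU _)); apply: (isoh_inj (i := p)).
by rewrite ep !compA -c -c' -!compA pv !compA.
Qed.

Lemma mates_prer X X' Y s t (f : hom X' X) : @mates X Y s t ->
  mates (s \oc (idm chi ⊗m fmap F f)) (t \oc (idm (L chi) ⊗m f)).
Proof.
rewrite /mates => c; rewrite fmapM (comp_rw2 (esym (tfun2_nat _ _ _))) !compA fmap1.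
by rewrite (comp_rw2 (tens_rl _ _)) -(tens_lr (eta chi)) compA c.
Qed.

Lemma mates_postl X Y Y' s t (f : hom Y Y') : @mates X Y s t ->
  mates ((fmap F f ⊗m idm chi) \oc s) ((f ⊗m idm (L chi)) \oc t).
Proof.
rewrite /mates => c; rewrite fmapM !(comp_rw3 c) !compA.
rewrite -tfun2_nat fmap1 (comp_rw2 (tens_lr _ _)) -(tens_rl (fmap F f)).
by rewrite !compA.
Qed.

(** The hexagon for [s] on [F X ⊗ F Y] corresponds to the hexagon for [t] on
[X ⊗ Y]. *)
Lemma mates_tens X Y s t s' t' : @mates X X s t -> @mates Y Y s' t' ->
  mates ((isoh (tfun2 F X Y) ⊗m idm chi)
        \oc isoi (massoc (F X) (F Y) chi)
        \oc (idm (F X) ⊗m s')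
        \oc isoh (massoc (F X) chi (F Y))
        \oc (s ⊗m idm (F Y))
        \oc isoi (massoc chi (F X) (F Y))
        \oc (idm chi ⊗m isoi (tfun2 F X Y)))
    (isoi (massoc X Y (L chi)) \oc (idm X ⊗m t') \oc isoh (massoc X (L chi) Y)
        \oc (t ⊗m idm Y) \oc isoi (massoc (L chi) X Y)).
Proof.
move=> c c'; rewrite /mates !fmapM.
have e : (idm chi ⊗m isoi (tfun2 F X Y)) \oc (idm chi ⊗m isoh (tfun2 F X Y)) = idm _.
  by rewrite -tens_compr isohK tensm1.
apply: (isoh_injr (i := tens_iso (iso_id chi) (tfun2 F X Y))) => /=.
have c1 : (fmap F t ⊗m idm (F Y)) \oc (isoh (tfun2 F (L chi) X) ⊗m idm (F Y))
    \oc ((eta chi ⊗m idm (F X)) ⊗m idm (F Y))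
  = (isoh (tfun2 F X (L chi)) ⊗m idm (F Y)) \oc ((idm (F X) ⊗m eta chi) ⊗m idm (F Y))
    \oc (s ⊗m idm (F Y)) by rewrite -!tens_compl c.
have c2 : (idm (F X) ⊗m fmap F t') \oc (idm (F X) ⊗m isoh (tfun2 F (L chi) Y))
    \oc (idm (F X) ⊗m (eta chi ⊗m idm (F Y)))
  = (idm (F X) ⊗m isoh (tfun2 F Y (L chi))) \oc (idm (F X) ⊗m (idm (F Y) ⊗m eta chi))
    \oc (idm (F X) ⊗m s') by rewrite -!tens_compr c'.
rewrite !compA (comp_rw2 e) compm1 (comp_rw2 (tens_lr _ _)).
rewrite -(tens_rl (eta chi)) !compA.
rewrite (comp_rw3 (tfun2_massoci _ _ _ _)) !compA.
rewrite -(tensm1 (F X) (F Y)) (comp_rw2 (massoci_nat _ _ _)) !compA.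
rewrite (comp_rw2 (esym (tfun2_nat _ _ _))) !compA fmap1 (comp_rw3 c1) !compA.
rewrite (comp_rw3 (tfun2_assoc _ _ _ _)) !compA (comp_rw2 (massoc_nat _ _ _)) !compA.
rewrite (comp_rw2 (esym (tfun2_nat _ _ _))) !compA fmap1 (comp_rw3 c2) !compA.
rewrite tfun2_massoci (comp_rw2 (massoci_nat _ _ _)) !compA tensm1.
by rewrite (comp_rw2 (tens_lr _ _)) -(tens_rl (isoh (tfun2 F X Y))) !compA.
Qed.

Lemma mates_unit :
  mates ((isoh (tfun0 F) ⊗m idm chi) \oc isoi (lunit chi) \oc isoh (runit chi)
      \oc (idm chi ⊗m isoi (tfun0 F)))
    (isoi (lunit (L chi)) \oc isoh (runit (L chi))).
Proof.
rewrite /mates fmapM.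
apply: (isoh_injr (i := tens_iso (iso_id chi) (tfun0 F))) => /=.
have e : fmap F (isoi (lunit (L chi))) = isoh (tfun2 F (munit C) (L chi))
    \oc (isoh (tfun0 F) ⊗m idm (F (L chi))) \oc isoi (lunit (F (L chi))).
  apply: (isoh_inj (i := fmap_iso F (lunit (L chi)))).
  by rewrite isoiK !compA tfun_lunit isoiK.
rewrite !compA (comp_rw2 (tens_lr _ _)) -(tens_rl (eta chi)) !compA.
rewrite (comp_rw3 (tfun_runit _ _)) (comp_rw2 (runit_nat _)) compA e.
rewrite (comp_rw2 (luniti_nat _)) !compA (comp_rw2 (tens_lr _ _)).
rewrite (comp_rw2 (esym (tens_compr _ _ _))) isohK tensm1 compm1.
by rewrite (comp_rw2 (tens_rl _ _)).
Qed.

(** The composite half-braiding of [X ⊗ Y] moves [u] across [X], then across [Y]. *)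
Lemma half_braiding_tens X Y (t : hom (L chi ⊗ X) (X ⊗ L chi))
    (t' : hom (L chi ⊗ Y) (Y ⊗ L chi)) :
  t \oc (u ⊗m idm X) \oc isoi (lunit X) = (idm X ⊗m u) \oc isoi (runit X) ->
  t' \oc (u ⊗m idm Y) \oc isoi (lunit Y) = (idm Y ⊗m u) \oc isoi (runit Y) ->
  isoi (massoc X Y (L chi)) \oc (idm X ⊗m t') \oc isoh (massoc X (L chi) Y)
      \oc (t ⊗m idm Y) \oc isoi (massoc (L chi) X Y)
      \oc (u ⊗m idm (X ⊗ Y)) \oc isoi (lunit (X ⊗ Y))
    = (idm (X ⊗ Y) ⊗m u) \oc isoi (runit (X ⊗ Y)).
Proof.
move=> e e'; rewrite luniti_tens -(tensm1 X Y) (comp_rw2 (massoci_nat _ _ _)) !compA.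
rewrite isohKc.
have c1 : (t ⊗m idm Y) \oc ((u ⊗m idm X) ⊗m idm Y) \oc (isoi (lunit X) ⊗m idm Y)
  = ((idm X ⊗m u) ⊗m idm Y) \oc (isoi (runit X) ⊗m idm Y) by rewrite -!tens_compl e.
have c2 : (idm X ⊗m t') \oc (idm X ⊗m (u ⊗m idm Y)) \oc (idm X ⊗m isoi (lunit Y))
  = (idm X ⊗m (idm Y ⊗m u)) \oc (idm X ⊗m isoi (runit Y)) by rewrite -!tens_compr e'.
rewrite (comp_rw3 c1) !compA (comp_rw2 (massoc_nat _ _ _)) !compA.
rewrite (comp_rw2 (trianglei _ _)) (comp_rw3 c2) !compA massoci_nat tensm1.
by rewrite runiti_tens !compA.
Qed.

Lemma represent_centralizer :
  exists sigma : forall X : C, iso (chi ⊗ F X) (F X ⊗ chi),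
    @centralizer_object k C D F chi sigma.
Proof.
have /dependent_choice[s sP] X : exists s : iso (chi ⊗ F X) (F X ⊗ chi),
    exists2 t, mates (isoh s) t & t \oc (u ⊗m idm X) \oc isoi (lunit X)
      = (idm X ⊗m u) \oc isoi (runit X).
  have [v [pv vU]] := universal_at adjL uU X.
  have [w [pw wU]] := universal_atl X.
  have [s es] := universal_iso vU wU.
  have [p ep] := proj_iso adjL chi X.
  exists s; exists (projl chi X \oc fmap L (isoh s) \oc isoi p).
    by apply/matesP; rewrite -ep isohKc.
  have pv' : isoi p \oc (u ⊗m idm X) \oc isoi (lunit X) = v.
    by rewrite -compA -pv -ep compA isohK comp1m.
  by rewrite (comp_rw3 pv') -compA es pw.
have /dependent_choice[t tP] X : exists t,
    mates (isoh (s X)) t /\ t \oc (u ⊗m idm X) \oc isoi (lunit X)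
      = (idm X ⊗m u) \oc isoi (runit X).
  by have [t] := sP X; exists t.
have tu X := (tP X).2; have ts X := (tP X).1.
exists s; split.
- move=> X Y f; apply: mates_uniq (mates_prer f (ts Y)) (mates_postl f (ts X)) _.
  rewrite (comp_rw2 (tens_rl _ _)) -(tens_lr u) !compA.
  rewrite (comp_rw2 (esym (luniti_nat _))) !compA tu.
  by rewrite (comp_rw3 (tu X)) !compA tens_lr -(tens_rl f) -!compA -runiti_nat.
- apply: (isoh_injr (i := tens_iso (iso_id chi) (iso_sym (tfun0 F)))) => /=.
  rewrite (comp_rw2 (esym (tens_compr _ _ _))) isoiK tensm1 compm1.
  apply: (mates_uniq (ts (munit C)) mates_unit).
  rewrite tu (comp_rw2 (runit_nat _)) -luniti_unit -lunit_unit compA isoiKc.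
  by rewrite luniti_nat.
- move=> X Y.
  (* move the structure map to the other side, so that both maps start at
     chi ⊗ F (X ⊗ Y) and uniqueness applies *)
  apply: (isoh_injr (i := tens_iso (iso_id chi) (iso_sym (tfun2 F X Y)))) => /=.
  rewrite (comp_rw2 (esym (tens_compr _ _ _))) isoiK tensm1 compm1.
  apply: (mates_uniq (ts (X ⊗ Y)) (mates_tens (ts X) (ts Y))).
  by rewrite tu half_braiding_tens.
Qed.

End Consequences.

(** * The pairing between [L] and [R] *)

Section Pairing.
Context {k : fieldType} {C D : tensorCategory k} (F : tensorFunctor C D).
Variables (L R : functor D C) (adjL : adjunction L F) (adjR : adjunction F R).
Local Notation proj := (proj adjL).
Local Notation eps := (adj_counit adjL).
Local Notation kappa := (adj_counit adjR).

Lemma pairing_exists (W V : D) (d : dual_pair W V) :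
  exists e : hom (L W ⊗ R V) (munit C), e \oc proj W (R V)
    = eps _ \oc fmap L (isoh (tfun0 F) \oc (ev d \oc (idm W ⊗m kappa V))).
Proof.
have [p ep] := proj_iso adjL W (R V).
by exists (eps _ \oc fmap L (isoh (tfun0 F) \oc (ev d \oc (idm W ⊗m kappa V)))
  \oc isoi p); rewrite -ep isohKc.
Qed.

(** Induced from the evaluation [W ⊗ V -> 1], the counit [F (R V) -> V] and the
projection formula. *)
Definition pairing W V (d : dual_pair W V) : hom (L W ⊗ R V) (munit C) :=
  proj1_sig (constructive_indefinite_description _ (pairing_exists d)).

Lemma pairingE W V (d : dual_pair W V) : pairing d \oc proj W (R V)
  = eps _ \oc fmap L (isoh (tfun0 F) \oc (ev d \oc (idm W ⊗m kappa V))).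
Proof. by rewrite /pairing; case: constructive_indefinite_description. Qed.

(** Perfectness: [Hom(Y, R V) = Hom(F Y, V) = Hom(W ⊗ F Y, 1) = Hom(L W ⊗ Y, 1)]. *)
Lemma pairing_bij W V (d : dual_pair W V) Y :
  bijective (fun y : hom Y (R V) => pairing d \oc (idm (L W) ⊗m y)).
Proof.
have [p ep] := proj_iso adjL W Y.
apply: (bij_comp_cancell (bij_precomp (munit C) p)).
have b := bij_comp (adjTi_bij adjL _ _) (bij_comp (bij_postcomp _ (tfun0 F))
  (bij_comp (evl_bij d (F Y)) (adjTi_bij adjR Y V))).
apply: (eq_bij b) => y /=.
rewrite ep -compA -fmap1 -proj_nat !compA pairingE tens_compr.
by rewrite -!compA -fmapM -!compA.
Qed.

(** [R V] and a dual of [L W] given by rigidity represent the same functor, by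
[pairing_bij]. *)
Lemma pairing_form_bij W V (d : dual_pair W V) :
  bijective (fun a : hom (munit C) (L W) =>
    pairing d \oc (a ⊗m idm (R V)) \oc isoi (lunit (R V))).
Proof.
have [_ [B /left_dual_pair[e]]] := tcat_rigid (L W).
have [h _ /(_ (ev e)) /=] := pairing_bij d B; set t := h _ => et.
have [i ei] : is_iso t.
  apply: yoneda_post => Z; apply: (bij_comp_cancell (pairing_bij d Z)).
  by apply: (eq_bij (evl_bij e Z)) => f /=; rewrite -et tens_compr compA.
apply: (bij_comp_cancell (bij_precomp _ i)).
apply: (eq_bij (form_of_bij e)) => a /=.
rewrite /form_of -et ei (comp_rw2 (tens_rl _ _)) (comp_rw2 (luniti_nat _)) !compA.
by rewrite (comp_rw2 (tens_lr _ _)).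
Qed.

Lemma pairing_extranat W V W2 V2 (d : dual_pair W V) (d2 : dual_pair W2 V2)
    (f : hom W W2) (g : hom V2 V) :
  ev d2 \oc (f ⊗m idm V2) = ev d \oc (idm W ⊗m g) ->
  pairing d2 \oc (fmap L f ⊗m idm (R V2)) = pairing d \oc (idm (L W) ⊗m fmap R g).
Proof.
move=> e; have [p ep] := proj_iso adjL W (R V2).
apply: (isoh_injr (i := p)); rewrite ep -!compA -(fmap1 L) -!proj_nat !compA.
rewrite !pairingE -!compA -!fmapM -!compA fmap1 tens_rl -tens_lr -tens_compr.
by rewrite adj_counit_nat tens_compr !(compA (ev _)) e.
Qed.

End Pairing.

(** * Equivalence of the universal arrow with the other descriptions *)

Section Represents.
Context {k : fieldType} {C D : tensorCategory k} (F : tensorFunctor C D).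
Variables (L R : functor D C) (adjL : adjunction L F) (adjR : adjunction F R).

(** The form [t] exhibits [chi'] as representing [V |-> Hom(R V, 1)].  Its partner
under the pairing of [L chi] with [R chi'] is the universal arrow. *)
Lemma universal_of_form (chi chi' : D) (d : dual_pair chi chi')
    (t : hom (R chi') (munit C)) :
  (forall V, bijective (fun g : hom V chi' => t \oc fmap R g)) ->
  exists u : hom (munit C) (L chi), universal_arrow u.
Proof.
move=> tU; have [h _ /(_ t) /=] := pairing_form_bij adjL adjR d; set u := h t => ut.
exists u => W; have [_ [W' /left_dual_pair[e]]] := tcat_rigid W.
apply: (bij_comp_cancell (pairing_form_bij adjL adjR e)).
have [g gK Kg] := evl_bij d W'.
have gB : bijective g by exists (fun y : hom W' chi' => ev d \oc (idm chi ⊗m y)).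
apply: (eq_bij (bij_comp (tU W') (bij_comp gB (ev_bij e chi)))) => f /=.
(* f' is the dual of f *)
set f' := g _; have ff' : ev e \oc (f ⊗m idm W') = ev d \oc (idm chi ⊗m f').
  by rewrite [RHS]Kg.
rewrite tens_compl compA (pairing_extranat adjL adjR ff').
rewrite (comp_rw2 (tens_rl _ _)) -(tens_lr u) !compA.
by rewrite (comp_rw2 (esym (luniti_nat _))) compA ut.
Qed.

(** Here the dual is on the side opposite to that of [universal_of_form], so the
two lemmas combine through the reversed functor. *)
Lemma universal_form_of_relative_modular (chi chi' : D) (d : dual_pair chi' chi) :
  relative_modular_object L R chi ->
  exists t : hom (R chi') (munit C),
    forall V, bijective (fun g : hom V chi' => t \oc fmap R g).
Proof.
case=> i.
exists (adj_counit adjL _ \oc fmap L (isoh (tfun0 F) \oc ev d)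
  \oc isoh (i chi')) => V.
have b := bij_comp (bij_precomp _ (i V)) (bij_comp (adjTi_bij adjL _ _)
  (bij_comp (bij_postcomp _ (tfun0 F)) (ev_bij d V))).
apply: (eq_bij b) => g /=.
have nat := natiso_nat i g; rewrite /= in nat.
by rewrite (comp_rw2 nat) !fmapM !compA.
Qed.

End Represents.

(** The adjoint [L0] in the isomorphism and the adjoint [L] in the conclusion may be
different left adjoints of [F]; the Frobenius criterion uses this freedom. *)
Lemma universal_of_relative_modular (k : fieldType) (C D : tensorCategory k)
    (F : tensorFunctor C D) (L0 L R : functor D C) (adjL0 : adjunction L0 F)
    (adjL : adjunction L F) (adjR : adjunction F R) (chi : D) :
  relative_modular_object L0 R chi ->
  exists u : hom (munit C) (L chi), universal_arrow u.
Proof.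
move=> rm; have [[chi' /left_dual_pair[d]] _] := tcat_rigid chi.
have [t tU] := universal_form_of_relative_modular adjL0 d rm.
exact: (@universal_of_form k (rev_tensor C) (rev_tensor D) (rev_functor F)
  L R adjL adjR chi chi' (rev_pair d) t tU).
Qed.

Lemma relative_modular_unit (k : fieldType) (C D : tensorCategory k)
    (L R : functor D C) :
  functor_isomorphic L R -> relative_modular_object L R (munit D).
Proof.
case=> j; split.
exists (fun V => iso_trans (iso_sym (j V)) (fmap_iso L (iso_sym (runit V)))).
move=> V W f /=.
apply: (isoh_injr (i := j V)); rewrite -!compA -natiso_nat !compA isohKc.
by rewrite isohKc -!fmapM runiti_nat.
Qed.

Lemma isomorphic_of_relative_modular (k : fieldType) (C D : tensorCategory k)
    (L R : functor D C) (chi : D) :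
  isomorphic chi (munit D) -> relative_modular_object L R chi ->
  functor_isomorphic L R.
Proof.
case=> i [j]; split.
exists (fun V => iso_trans (fmap_iso L (iso_trans (iso_sym (runit V))
  (tens_iso (iso_id V) (iso_sym i)))) (iso_sym (j V))) => V W f /=.
apply: (isoh_inj (i := j W)); rewrite !compA natiso_nat isoiK comp1m isoiKc /=.
by rewrite -!fmapM -compA runiti_nat !compA tens_rl tens_lr.
Qed.

Theorem proposition4p7 (k : fieldType) (C D : tensorCategory k)
    (F : tensorFunctor C D) (L R : functor D C)
    (adjL : adjunction L F) (adjR : adjunction F R)
    (hF : has_left_adjoint L \/ has_right_adjoint R \/
          (exists chi : D, relative_modular_object L R chi)) :
  (exists chi : D, relative_modular_object L R chi) /\
  (forall chi : D, relative_modular_object L R chi ->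
    [/\ isomorphic chi (munit D) <-> frobenius F,
        invertible chi
      & exists sigma : forall X : C, iso (tens chi (F X)) (tens (F X) chi),
          @centralizer_object k C D F chi sigma]).
Proof.
split.
  case: hF => [[E [adjE]]|[[G [adjG]]|//]].
    exists (E (munit C)).
    apply: (@represent_relative_modular _ _ _ _ _ adjL _ (adj_unit adjE _)) adjR.
    by move=> W; apply: adjT_bij.
  have [[chi /left_dual_pair[d]] _] := tcat_rigid (G (munit C)).
  have [u uU] := universal_of_form adjL adjR d (fun V => adjTi_bij adjG V _).
  by exists chi; exact: (represent_relative_modular adjL uU adjR).
move=> chi rm; have [u uU] := universal_of_relative_modular adjL adjL adjR rm.
split; last exact: (represent_centralizer adjL uU).
  split=> [i|[L' [R' [[adjL'] [adjR'] LR']]]].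
    by exists L, R; split=> //; apply: isomorphic_of_relative_modular i rm.
  have [u' uU'] :=
    universal_of_relative_modular adjL' adjL adjR' (relative_modular_unit LR').
  by have [i _] := universal_iso uU uU'.
exact: (represent_invertible adjL uU).
Qed.
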